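(* Let $C\subset\mathbb{R}^n$ be a closed cone, let $K\subset C$ be nonempty, closed, unbounded and convex, let $U\subset\mathbb{R}^n$ be an open set containing $K$, and let $f:C\cup U\to\mathbb{R}$ be continuous on $C$, weakly homogeneous of degree $\alpha>0$ relative to $K$, differentiable on $U$ and pseudoconvex on $U$. Assume that $\mathcal{K}(K,f)$ is non-trivial (i.e. unbounded). Then the following statements are equivalent: (a) For each $v\in\mathcal{K}(K,f)\setminus\{0\}$, there exists $x\in K$ such that $\langle\nabla f(x),v\rangle>0$; (b) $\operatorname{Sol}(K,f)$ is nonempty and bounded.
   Context: A cone is a nonempty set closed under multiplication by positive scalars. For a nonempty closed set $S\subset\mathbb{R}^n$, the asymptotic cone is $S^{\infty}=\{v\in\mathbb{R}^n:\exists t_k\to+\infty,\ \exists x^k\in S,\ \lim_{k\to\infty} x^k/t_k=v\}$. $f$ is weakly homogeneous of degree $\alpha>0$ relative to $K$ if there is a continuous function $h:C\to\mathbb{R}$, positively homogeneous of degree $\alpha$ (that is, $h(tx)=t^{\alpha}h(x)$ for all $x\in C$, $t>0$), such that $f(x)-h(x)=o(\|x\|^{\alpha})$ on $K$ (i.e. $(f(x)-h(x))/\|x\|^{\alpha}\to 0$ as $\|x\|\to\infty$ with $x\in K$). Any such $h$ is called an asymptotically homogeneous function of $f$ relative to $K$ and is denoted $f^{\infty}$; all such $h$ have the same values on $K^{\infty}$, so the kernel below does not depend on the choice. For a nonempty closed set $S$ and a continuous function $g$ on $S$, $\operatorname{Sol}(S,g)$ is the set of global minimizers of $g$ over $S$.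 The kernel is $\mathcal{K}(K,f):=\operatorname{Sol}(K^{\infty},f^{\infty})$. A function $f$ differentiable on the open set $U$ is pseudoconvex on $U$ if for any $x,y\in U$ with $\langle\nabla f(x),y-x\rangle\ge 0$ one has $f(y)\ge f(x)$. *)

(* Defs.v *)
From HB Require Import structures.
From mathcomp Require Import all_boot all_order all_algebra.
From mathcomp Require Import all_classical all_reals all_analysis.

Set Implicit Arguments.
Unset Strict Implicit.
Unset Printing Implicit Defensive.

Import Order.TTheory GRing.Theory Num.Theory.
Import numFieldNormedType.Exports.

Local Open Scope classical_set_scope.
Local Open Scope ring_scope.

Definition dotv {R : realType} {n : nat} (u v : 'rV[R]_n) : R :=
  \sum_(i < n) u 0 i * v 0 i.

(* The norm [`|x|] of the library on ['rV[R]_n] is the sup norm. *)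
Definition enorm {R : realType} {n : nat} (x : 'rV[R]_n) : R :=
  Num.sqrt (dotv x x).

Definition gradient {R : realType} {n : nat} (f : 'rV[R]_n -> R)
    (x : 'rV[R]_n) : 'rV[R]_n :=
  \row_(i < n) 'D_(delta_mx 0 i) f x.

Definition cone {R : realType} {n : nat} (C : set 'rV[R]_n) : Prop :=
  C !=set0 /\ forall (t : R) (x : 'rV[R]_n), 0 < t -> C x -> C (t *: x).

Definition asymptotic_cone {R : realType} {n : nat} (S : set 'rV[R]_n) :
    set 'rV[R]_n :=
  [set v | exists (t : nat -> R) (x : nat -> 'rV[R]_n),
     [/\ t k @[k --> \oo] --> +oo,
         forall k, S (x k) &
         (t k)^-1 *: x k @[k --> \oo] --> v]].

Definition pos_homogeneous {R : realType} {n : nat} (C : set 'rV[R]_n)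
    (alpha : R) (h : 'rV[R]_n -> R) : Prop :=
  forall (x : 'rV[R]_n) (t : R), C x -> 0 < t -> h (t *: x) = t `^ alpha * h x.

(* [h] is an asymptotically homogeneous function of [f] relative to [K];
   only the values of [h] on [C] and of [f] on [K] matter. *)
Definition asymptotically_homogeneous {R : realType} {n : nat}
    (C K : set 'rV[R]_n) (alpha : R) (f h : 'rV[R]_n -> R) : Prop :=
  [/\ {within C, continuous h},
      pos_homogeneous C alpha h &
      forall e : R, 0 < e -> exists M : R, forall x : 'rV[R]_n,
        K x -> M < enorm x -> `|(f x - h x) / enorm x `^ alpha| < e].

Definition Sol {R : realType} {n : nat} (S : set 'rV[R]_n)
    (g : 'rV[R]_n -> R) : set 'rV[R]_n :=
  [set x | S x /\ forall y, S y -> g x <= g y].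

(* [h] stands for the asymptotically homogeneous function of the objective. *)
Definition asymptotic_kernel {R : realType} {n : nat} (K : set 'rV[R]_n)
    (h : 'rV[R]_n -> R) : set 'rV[R]_n :=
  Sol (asymptotic_cone K) h.

Definition pseudoconvex {R : realType} {n : nat} (U : set 'rV[R]_n)
    (f : 'rV[R]_n -> R) : Prop :=
  forall x y : 'rV[R]_n, U x -> U y ->
    0 <= dotv (gradient f x) (y - x) -> f x <= f y.

(* Main.v *)
(** A first-order consequence of pseudoconvexity on the convex set [K]:
    [f y <= f x] implies [<grad f x, y - x> <= 0]; otherwise [f] restricted to
    the segment [[x, y]] has an interior maximum with value above [f x], and
    pseudoconvexity at this critical point gives a contradiction.

    (a) => (b): if (b) fails, there are [u k] in [K] with [`|u k| >= k] and
    [f (u k) <= f] on [K] intersected with the ball of radius [k], since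
    otherwise [f] would attain its minimum, and only inside some ball. A limit
    [v] of [u k / |u k|] lies in the asymptotic cone and [finf v <= 0], whereas
    [finf >= 0] on that cone because the kernel is nonempty and [finf] is
    homogeneous of positive degree; so [v] is a nonzero kernel element.
    Dividing [<grad f x, u k - x> <= 0] by [|u k|] gives [<grad f x, v> <= 0]
    for every [x] in [K], against (a).

    (b) => (a): a nonzero kernel element [v] is a recession direction of [K].
    If [<grad f, v> <= 0] on [K] and [x] is a minimizer, pseudoconvexity at
    [x + s v] towards [x] gives [f (x + s v) <= f x], so the whole ray consists
    of minimizers. *)
Require Import Defs.
From mathcomp Require Import all_boot all_order all_algebra.
From mathcomp Require Import all_classical all_reals all_analysis.
From mathcomp Require Import lra.

Set Implicit Arguments.
Unset Strict Implicit.
Unset Printing Implicit Defensive.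

Import Order.TTheory GRing.Theory Num.Theory.
Import numFieldNormedType.Exports.
Local Open Scope classical_set_scope.
Local Open Scope ring_scope.

(** * Inner product, Euclidean norm and sup norm *)

Lemma dotvZr {R : realType} {n : nat} (a : R) (u v : 'rV[R]_n) :
  dotv u (a *: v) = a * dotv u v.
Proof.
by rewrite /dotv mulr_sumr; apply: eq_bigr => i _; rewrite mxE mulrCA.
Qed.

Lemma dotvC {R : realType} {n : nat} (u v : 'rV[R]_n) : dotv u v = dotv v u.
Proof. by apply: eq_bigr => i _; rewrite mulrC. Qed.

Lemma dotv_ge0 {R : realType} {n : nat} (u : 'rV[R]_n) : 0 <= dotv u u.
Proof. by apply: sumr_ge0 => i _; rewrite -expr2 sqr_ge0. Qed.

Lemma cvg_dotv {R : realType} {n : nat} {T : Type} {F : set_system T}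
    {FF : Filter F} (u v : T -> 'rV[R]_n) (a b : 'rV[R]_n) :
  u @ F --> a -> v @ F --> b -> dotv (u x) (v x) @[x --> F] --> dotv a b.
Proof.
move=> ua vb.
apply: (cvg_big (op := +%R)) => [|i _]; first exact: add_continuous.
by apply: cvgM; apply: (cvg_comp _ (fun w : 'rV[R]_n => w 0 i) _
  (@coord_continuous _ _ _ 0 i _)).
Qed.

(** Boundedness and compactness are in the sup norm, growth conditions in the Euclidean one; this
    inequality links them. *)
Lemma enorm_ge_norm {R : realType} {n : nat} (x : 'rV[R]_n) : `|x| <= enorm x.
Proof.
rewrite [leLHS]mx_normrE; apply/bigmax_leP; split; first exact: sqrtr_ge0.
move=> [i j] _ /=; rewrite ord1 -sqrtr_sqr ler_wsqrtr //.
rewrite /dotv (bigD1 j) //= expr2 lerDl.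
by apply: sumr_ge0 => k _; rewrite -expr2 sqr_ge0.
Qed.

Lemma sqr_enorm {R : realType} {n : nat} (x : 'rV[R]_n) :
  enorm x ^+ 2 = dotv x x.
Proof. by rewrite sqr_sqrtr ?dotv_ge0. Qed.

(** * Derivatives along lines *)

Lemma dotv_gradient {R : realType} {n : nat} (f : 'rV[R]_n -> R)
    (x v : 'rV[R]_n) :
  differentiable f x -> dotv (gradient f x) v = 'D_v f x.
Proof.
move=> fx; rewrite deriveE // {2}(row_sum_delta v) linear_sum.
apply: eq_bigr => i _.
by rewrite mxE deriveE // linearZ /= mulrC.
Qed.

(** These are the difference quotients of [s |-> f (x + s *: d)] at [t] and of [f] at [x + t *: d]
    along [d]; their equality transfers both existence and value of the derivative. *)
Lemma line_difference_quotient {R : realType} {n : nat} (f : 'rV[R]_n -> R)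
    (x d : 'rV[R]_n) (t : R) :
  (fun h : R => h^-1 *: (f (x + (h *: 1 + t) *: d) - f (x + t *: d))) =
  (fun h : R => h^-1 *: (f (h *: d + (x + t *: d)) - f (x + t *: d))).
Proof.
apply/funext => h; congr (_ *: (f _ - _)).
by rewrite scalerDl /GRing.scale /= mulr1 addrCA.
Qed.

Lemma derivable_line {R : realType} {n : nat} (f : 'rV[R]_n -> R)
    (x d : 'rV[R]_n) (t : R) :
  differentiable f (x + t *: d) -> derivable (fun s : R => f (x + s *: d)) t 1.
Proof.
move=> /(@diff_derivable _ _ _ _ _ d).
by rewrite /derivable line_difference_quotient.
Qed.

Lemma derive_line {R : realType} {n : nat} (f : 'rV[R]_n -> R)
    (x d : 'rV[R]_n) (t : R) :
  'D_1 (fun s : R => f (x + s *: d)) t = 'D_d f (x + t *: d).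
Proof. by rewrite /derive line_difference_quotient. Qed.

(** * Segments in a convex set and pseudoconvexity *)

Lemma convex_segment {R : realType} {n : nat} (K : set 'rV[R]_n)
    (x y : 'rV[R]_n) (t : R) :
  convex_set (K : set (convex_lmodType 'rV[R]_n)) ->
  K x -> K y -> 0 <= t <= 1 -> K (x + t *: (y - x)).
Proof.
move=> cK Kx Ky /andP[t0 t1].
have := cK y x (Itv01 t0 t1).
rewrite !inE => /(_ Ky Kx); congr (K _).
rewrite -[LHS]/(t *: y + (1 - t) *: x).
by rewrite scalerBl scale1r scalerBr addrCA.
Qed.

Lemma derive_gt0_increase {R : realType} (g : R -> R) :
  derivable g 0 1 -> 0 < 'D_1 g 0 -> exists2 t, 0 < t < 1 & g 0 < g t.
Proof.
move=> dg g'0; have := cvgr_gt ('D_1 g 0) dg _ g'0.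
case=> e /= e0 He.
pose t := Num.min (e / 2) 2^-1.
have t0 : 0 < t by rewrite lt_min divr_gt0 //= invr_gt0.
have te : t < e.
  by rewrite gt_min ltr_pdivrMr // ltr_pMr // ltr1n.
exists t; first by rewrite t0 gt_min invf_lt1 // ltr1n orbT.
have := He t.
rewrite /= sub0r normrN gtr0_norm // te gt_eqF // => /(_ isT isT).
rewrite addr0 [_%:A]mulr1 => h.
by rewrite -subr_gt0; move: h; rewrite /GRing.scale /= pmulr_rgt0 // invr_gt0.
Qed.

Lemma pseudoconvex_gradient_le0 {R : realType} {n : nat}
    (K U : set 'rV[R]_n) (f : 'rV[R]_n -> R) (x y : 'rV[R]_n) :
  convex_set (K : set (convex_lmodType 'rV[R]_n)) -> K `<=` U ->
  (forall z, U z -> differentiable f z) -> pseudoconvex U f ->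
  K x -> K y -> f y <= f x -> dotv (gradient f x) (y - x) <= 0.
Proof.
move=> cK KU df pf Kx Ky fyx; rewrite leNgt; apply/negP => grad_gt0.
pose g t := f (x + t *: (y - x)).
have Uxy t : 0 <= t <= 1 -> U (x + t *: (y - x)).
  by move=> t01; apply: KU; exact: convex_segment.
have dg t : 0 <= t <= 1 -> derivable g t 1.
  by move=> t01; apply: derivable_line; apply: df; exact: Uxy.
have Dg t : 0 <= t <= 1 ->
    'D_1 g t = dotv (gradient f (x + t *: (y - x))) (y - x).
  by move=> t01; rewrite derive_line dotv_gradient //; apply: df; exact: Uxy.
have x0 : x + 0 *: (y - x) = x by rewrite scale0r addr0.
have l01 : (0 : R) <= (0 : R) <= (1 : R) by rewrite lexx ler01.
have [s s01 gs] : exists2 s, 0 < s < 1 & g 0 < g s.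
  by apply: derive_gt0_increase; rewrite ?Dg ?x0 //; exact: dg.
have gc : {within `[0, 1], continuous g}.
  by apply: derivable_within_continuous => t; rewrite in_itv /= => /dg.
(* The maximum exceeds [g 0], hence also [g 1], so [c] is interior and [g] is critical there. *)
have [c c01 gmax] := EVT_max (@ler01 R) gc.
have g0c : g 0 < g c.
  apply: lt_le_trans gs (gmax _ _).
  by rewrite in_itv /= !ltW //; case/andP: s01.
have g10 : g 1 <= g 0.
  by rewrite /g x0 scale1r addrC subrK.
have c0 : c != 0 by apply: contraTneq g0c => ->; rewrite ltxx.
have c1 : c != 1 by apply: contraTneq g0c => ->; rewrite -leNgt.
move: c01; rewrite in_itv /= => c01; have /andP[c_ge0 c_le1] := c01.
have : is_derive c 1 g 0.
  apply: (derive1_at_max (@ler01 R)).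
  - by move=> t; rewrite in_itv /= => /andP[? ?]; apply: dg; rewrite !ltW.
  - by rewrite in_itv /= !lt_neqAle c_ge0 c_le1 c1 eq_sym c0.
  - move=> t; rewrite in_itv /= => /andP[? ?]; apply: gmax.
    by rewrite in_itv /= !ltW.
move=> /@derive_val; rewrite Dg // => Dgc0.
suff : g c <= g 0 by rewrite leNgt g0c.
rewrite /g x0.
(* The direction from the critical point to [x] is [- c *: (y - x)], along which the derivative
   vanishes. *)
apply: pf; [exact: Uxy|exact: KU|].
by rewrite opprD addNKr -scaleNr dotvZr Dgc0 mulr0.
Qed.

(** * Recession directions, subsequences and growth of powers *)

Lemma recession_direction {R : realType} {n : nat} (K : set 'rV[R]_n)
    (x v : 'rV[R]_n) (s : R) :
  closed K -> convex_set (K : set (convex_lmodType 'rV[R]_n)) ->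
  asymptotic_cone K v -> K x -> 0 <= s -> K (x + s *: v).
Proof.
move=> clK cK [t [u [toy Ku uv]]] Kx s0.
have t_gt0 : \forall k \near \oo, 0 < t k by move/cvgryPgt : toy; exact.
have ti0 : (t k)^-1 @[k --> \oo] --> 0 by apply/gtr0_cvgV0.
(* These points lie on the segments from [x] to [u k] once [s <= t k]; closedness of [K] gives the
   limit. *)
have : x + (s / t k) *: (u k - x) @[k --> \oo] --> x + s *: v.
  have -> : (fun k => x + (s / t k) *: (u k - x)) =
            (fun k => x + s *: ((t k)^-1 *: u k - (t k)^-1 *: x)).
    by apply/funext => k; rewrite -scalerBr scalerA.
  apply: cvgD; first exact: cvg_cst.
  apply: cvgZr; rewrite -[X in _ --> X]subr0 -(scale0r x).
  by apply: cvgB => //; exact: cvgZl.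
apply: (closed_cvg _ clK).
have t_ges : \forall k \near \oo, s <= t k by move/cvgryPge : toy; exact.
near=> k; apply: convex_segment => //.
have tk0 : 0 < t k by near: k.
apply/andP; split; first by rewrite divr_ge0 // ltW.
by rewrite ler_pdivrMr // mul1r; near: k.
Unshelve. all: by end_near. Qed.

(** Choose an index [phi m >= m] whose term is within [1 / (m + 1)] of a cluster point. Monotonicity
    of [phi] is not claimed: [m <= phi m] suffices to carry over eventual properties. *)
Lemma compact_cvg_subseq {R : realType} {V : normedModType R} (A : set V)
    (u : nat -> V) :
  compact A -> (forall k, A (u k)) ->
  exists2 phi : nat -> nat, forall m, (m <= phi m)%N &
    exists2 v, A v & u (phi m) @[m --> \oo] --> v.
Proof.
move=> cA Au.
have [|v [Av clv]] := cA (u @ \oo) _; first by exists 0%N => // k _ /=.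
have /choice[phi Hphi] m : exists k, (m <= k)%N /\ `|v - u k| < m.+1%:R^-1.
  have [_ [[k mk <-] vk]] : [set u k | k in [set k | (m <= k)%N]] `&`
      ball v m.+1%:R^-1 !=set0.
    apply: clv; last by apply: nbhsx_ballx; rewrite invr_gt0.
    by exists m => // k /= mk; exists k.
  by exists k; split => //; move: vk; rewrite -ball_normE.
exists phi; first by move=> m; have [] := Hphi m.
exists v => //; apply/cvgrPdist_lt => _/posnumP[e].
near=> m; have [_ /lt_trans] := Hphi m; apply.
by near: m; exact: near_infty_natSinv_lt.
Unshelve. all: by end_near. Qed.

Lemma powR_cvgy {R : realType} {T : Type} {F : set_system T} {FF : Filter F}
    (r : T -> R) (a : R) :
  0 < a -> r x @[x --> F] --> +oo -> r x `^ a @[x --> F] --> +oo.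
Proof.
move=> a0 /cvgryPge ry; apply/cvgryPge => A.
near=> x; apply: (@le_trans _ _ `|A|); first exact: ler_norm.
rewrite -[leLHS]powRr1 // -(mulVf (lt0r_neq0 a0)) powRrM.
have rx : `|A| `^ a^-1 <= r x by near: x.
apply: ge0_ler_powR; rewrite ?nnegrE ?powR_ge0 //; first exact: ltW.
by rewrite (le_trans _ rx) // powR_ge0.
Unshelve. all: by end_near. Qed.

(** * The asymptotic function and the kernel *)

Lemma closed_cone_cvg {R : realType} {n : nat} (C : set 'rV[R]_n)
    (r : nat -> R) (u : nat -> 'rV[R]_n) (v : 'rV[R]_n) :
  closed C -> cone C -> r k @[k --> \oo] --> +oo -> (forall k, C (u k)) ->
  (r k)^-1 *: u k @[k --> \oo] --> v -> C v.
Proof.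
move=> clC [_ coneC] ry Cu; apply: (closed_cvg _ clC).
have r_gt0 : \forall k \near \oo, 0 < r k by move/cvgryPgt : ry; exact.
by near=> k; apply: coneC => //; rewrite invr_gt0; near: k.
Unshelve. all: by end_near. Qed.

(** With [r = enorm (u k)], homogeneity turns [h] at the normalized point into
    [h (u k) / r ^ alpha], which is at most [M / r ^ alpha + o(1)] and so has a nonpositive
    limit. *)
Lemma asymptotic_limit_le0 {R : realType} {n : nat} (C K : set 'rV[R]_n)
    (alpha M : R) (f h : 'rV[R]_n -> R) (u : nat -> 'rV[R]_n) (v : 'rV[R]_n) :
  closed C -> cone C -> K `<=` C -> 0 < alpha ->
  asymptotically_homogeneous C K alpha f h -> (forall k, K (u k)) ->
  enorm (u k) @[k --> \oo] --> +oo -> (\forall k \near \oo, f (u k) <= M) ->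
  (enorm (u k))^-1 *: u k @[k --> \oo] --> v -> h v <= 0.
Proof.
move=> clC coneC KC a0 [hc hh hf] Ku uy fM uv.
have r_gt0 : \forall k \near \oo, 0 < enorm (u k).
  by move/cvgryPgt : uy; exact.
have Cu k : C (u k) by exact: KC.
have Cv : C v := closed_cone_cvg clC coneC uy Cu uv.
have hv : h ((enorm (u k))^-1 *: u k) @[k --> \oo] --> h v.
  move=> A hA; have /(_ A hA) := (subspace_continuousP _ _).1 hc v Cv.
  move=> /uv; apply: filterS2 r_gt0 => k r0; apply.
  by apply: coneC.2; [rewrite invr_gt0|exact: Cu].
apply/ler_addgt0Pl => e e0; rewrite addr0.
(* Half of [e] absorbs the error [f - h], the other half the bound [M], both relative to
   [enorm (u k) ^ alpha]. *)
have [N HN] := hf _ (divr_gt0 e0 (ltr0n R 2)).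
have ry : enorm (u k) `^ alpha @[k --> \oo] --> +oo by exact: powR_cvgy.
have Mr : \forall k \near \oo, `|M| / (e / 2) <= enorm (u k) `^ alpha.
  by move/cvgryPge : ry; exact.
have Nr : \forall k \near \oo, N < enorm (u k) by move/cvgryPgt : uy; exact.
apply: (cvgr_to_le hv); near=> k.
have r0 : 0 < enorm (u k) by near: k.
have ra0 : 0 < enorm (u k) `^ alpha by rewrite powR_gt0.
rewrite hh ?invr_gt0 //.
rewrite -powR_inv1 ?sqrtr_ge0 // -powRrM mulN1r powRN.
have : `|(f (u k) - h (u k)) / enorm (u k) `^ alpha| < e / 2.
  by apply: HN => //; near: k.
have : `|M| / (e / 2) <= enorm (u k) `^ alpha by near: k.
have : f (u k) <= M by near: k.
rewrite ltr_norml ltr_pdivlMr // [_ / (e / 2) <= _]ler_pdivrMr ?divr_gt0 //.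
rewrite [_^-1 * _]mulrC [h (u k) / _ <= _]ler_pdivrMr // => fM' MM /andP[fh _].
have := ler_norm M; lra.
Unshelve. all: by end_near. Qed.

Lemma asymptotic_coneZ {R : realType} {n : nat} (K : set 'rV[R]_n) (c : R)
    (v : 'rV[R]_n) :
  0 < c -> asymptotic_cone K v -> asymptotic_cone K (c *: v).
Proof.
move=> c0 [t [u [ty Ku uv]]]; exists (fun k => c^-1 * t k), u; split => //.
  apply/cvgryPge => A.
  have H : \forall k \near \oo, c * A <= t k by move/cvgryPge : ty; exact.
  by near=> k; rewrite mulrC ler_pdivlMr // mulrC; near: k.
under eq_fun do rewrite invfM invrK -scalerA.
exact: cvgZr.
Unshelve. all: by end_near. Qed.

Lemma asymptotic_kernel_ge0 {R : realType} {n : nat} (C K : set 'rV[R]_n)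
    (alpha : R) (h : 'rV[R]_n -> R) :
  closed C -> cone C -> K `<=` C -> 0 < alpha -> pos_homogeneous C alpha h ->
  asymptotic_kernel K h !=set0 ->
  forall v, asymptotic_cone K v -> 0 <= h v.
Proof.
move=> clC coneC KC a0 hh [w [Kw wmin]] v Kv.
apply: le_trans (wmin _ Kv).
have Cw : C w.
  case: Kw => t [u [ty Ku uw]].
  have Cu k : C (u k) by exact: KC.
  exact: closed_cone_cvg clC coneC ty Cu uw.
(* Comparing the minimizer [w] with [2 *: w] gives [(2 ^ alpha - 1) * h w >= 0], where
   [2 ^ alpha > 1]. *)
have := wmin _ (asymptotic_coneZ (ltr0n R 2) Kw).
rewrite hh // -subr_ge0 -{2}[h w]mul1r -mulrBl pmulr_rge0 // subr_gt0.
have : 1 `^ alpha < 2 `^ alpha :> R by rewrite gt0_ltr_powR ?nnegrE ?ltr1n.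
by rewrite powR1.
Qed.

Lemma kernel_descent_direction {R : realType} {n : nat} (C K U : set 'rV[R]_n)
    (alpha : R) (f h : 'rV[R]_n -> R) (u : nat -> 'rV[R]_n) :
  closed C -> cone C -> K `<=` C -> K !=set0 ->
  convex_set (K : set (convex_lmodType 'rV[R]_n)) -> K `<=` U -> 0 < alpha ->
  asymptotically_homogeneous C K alpha f h ->
  (forall x, U x -> differentiable f x) -> pseudoconvex U f ->
  asymptotic_kernel K h !=set0 ->
  (forall k, K (u k)) -> (forall k, k%:R <= `|u k|) ->
  (forall x, K x -> \forall k \near \oo, f (u k) <= f x) ->
  exists2 v, (asymptotic_kernel K h `\ 0) v &
    forall x, K x -> dotv (gradient f x) v <= 0.
Proof.
move=> clC coneC KC [x0 Kx0] cK KU a0 fh df pf kn0 Ku uk fu.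
pose y k := (enorm (u k))^-1 *: u k.
have yB k : closed_ball_ Num.norm 0 1 (y k).
  rewrite /closed_ball_ /= sub0r normrN normrZ normfV.
  (* If [u k] vanishes, the convention that the inverse of 0 is 0 makes [y k] zero, still in the
     ball. *)
  have [->|r0] := eqVneq (enorm (u k)) 0; first by rewrite normr0 invr0 mul0r.
  rewrite ger0_norm ?sqrtr_ge0 // mulrC ler_pdivrMr ?mul1r ?enorm_ge_norm //.
  by rewrite lt_neqAle eq_sym r0 sqrtr_ge0.
have cB : compact (closed_ball_ Num.norm (0 : 'rV[R]_n) 1).
  apply: bounded_closed_compact; last exact: closed_closed_ball_.
  exists 1; split => // r r1 x; rewrite /closed_ball_ /= sub0r normrN.
  by move=> /le_trans; apply; exact: ltW.
have [phi phim [v _ yv]] := compact_cvg_subseq cB yB.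
pose w m := u (phi m).
have wy : enorm (w m) @[m --> \oo] --> +oo.
  apply/cvgryPge => A; near=> m.
  rewrite (le_trans _ (enorm_ge_norm _)) // (le_trans _ (uk _)) //.
  rewrite (@le_trans _ _ m%:R) ?ler_nat //.
  by near: m; exact: nbhs_infty_ger.
have fw x : K x -> \forall m \near \oo, f (w m) <= f x.
  move=> /fu[N _ HN]; exists N => // m /= Nm; apply: HN => /=.
  exact: leq_trans Nm (phim m).
have Kw m : K (w m) by exact: Ku.
have r_gt0 : \forall m \near \oo, 0 < enorm (w m).
  by move/cvgryPgt : wy; exact.
have Kv : asymptotic_cone K v by exists (enorm \o w), w; split.
have [_ hh _] := fh.
have hge0 := asymptotic_kernel_ge0 clC coneC KC a0 hh kn0.
have hv : h v <= 0.
  exact: (asymptotic_limit_le0 clC coneC KC a0 fh Kw wy (fw _ Kx0)).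
(* The normalized points eventually have Euclidean norm 1, so the limit [v] does too and is
   nonzero. *)
have vv : dotv v v = 1.
  have yyv : dotv (y (phi m)) (y (phi m)) @[m --> \oo] --> dotv v v.
    exact: cvg_dotv.
  rewrite -(cvg_lim _ yyv) //.
  apply: lim_near_cst => //; near=> m.
  have r0 : 0 < enorm (w m) by near: m.
  rewrite dotvZr dotvC dotvZr -/(w m) -sqr_enorm expr2 !mulKf ?gt_eqF //.
  by rewrite mulVf ?gt_eqF.
exists v; first split.
- by split => // z /hge0; exact: le_trans.
- move=> /= v0; move: vv; rewrite v0 /dotv big1 => [/esym/eqP|i _].
    by rewrite oner_eq0.
  by rewrite mxE mul0r.
- move=> x Kx.
  have ri0 : (enorm (w m))^-1 @[m --> \oo] --> 0 by apply/gtr0_cvgV0.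
  (* Subtracting the vanishing term [x / enorm (w m)] keeps the limit and yields a positive multiple
     of [w m - x], to which the gradient inequality applies. *)
  have : dotv (gradient f x) (y (phi m) - (enorm (w m))^-1 *: x) @[m --> \oo]
      --> dotv (gradient f x) v.
    apply: cvg_dotv; first exact: cvg_cst.
    rewrite -[X in _ --> X]subr0 -(scale0r x).
    by apply: cvgB => //; exact: cvgZl.
  move=> /cvgr_to_le; apply.
  near=> m; rewrite -scalerBr dotvZr mulr_ge0_le0 ?invr_ge0 ?sqrtr_ge0 //.
  apply: (pseudoconvex_gradient_le0 cK KU df pf Kx (Kw m)).
  by near: m; exact: fw.
Unshelve. all: by end_near. Qed.

(** * Existence and boundedness of minimizers *)

Lemma Sol_nonempty_bounded {R : realType} {n : nat} (K : set 'rV[R]_n)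
    (f : 'rV[R]_n -> R) (r : R) :
  closed K -> K !=set0 -> {within K, continuous f} ->
  (forall x, K x -> r <= `|x| ->
    exists y, [/\ K y, `|y| <= r & f y < f x]) ->
  Sol K f !=set0 /\ bounded_set (Sol K f).
Proof.
move=> clK [x0 Kx0] fc Hr.
pose B := K `&` closed_ball_ Num.norm (0 : 'rV[R]_n) r.
have BE x : B x <-> K x /\ `|x| <= r.
  by rewrite /B /closed_ball_ /setI /= sub0r normrN.
have B0 : B !=set0.
  have [x0r|/ltW /(Hr _ Kx0)[z [Kz zr _]]] := leP `|x0| r.
    by exists x0; apply/BE.
  by exists z; apply/BE.
have cB : compact B.
  apply: bounded_closed_compact.
    exists r; split => [|s rs x /BE[_ xr]]; first exact: num_real.
    exact: le_trans xr (ltW rs).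
  by apply: closedI => //; exact: closed_closed_ball_.
have fB : {within B, continuous f}.
  by apply: continuous_subspaceW fc; exact: subIsetl.
have [c] := compact_EVT_min B0 cB fB.
rewrite inE => /BE[Kc cr] cmin.
have cmin' z : K z -> `|z| <= r -> f c <= f z.
  by move=> Kz zr; apply: cmin; rewrite inE; apply/BE.
(* A point outside the ball is beaten by one inside, so the minimum over the compact set [B] is
   global. *)
have csol z : K z -> f c <= f z.
  move=> Kz; have [zr|/ltW /(Hr _ Kz)[t [Kt tr tz]]] := leP `|z| r.
    exact: cmin'.
  exact: le_trans (cmin' _ Kt tr) (ltW tz).
split; first by exists c.
exists r; split => [|s rs x [Kx xmin] /=]; first exact: num_real.
rewrite (le_trans _ (ltW rs)) // leNgt; apply/negP => /ltW /(Hr _ Kx)[t [Kt _]].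
by rewrite ltNge xmin.
Qed.

Unset Implicit Arguments.

Theorem theorem4p2 (R : realType) (n : nat) (C K U : set 'rV[R]_n)
    (alpha : R) (f finf : 'rV[R]_n -> R)
    (C_closed : closed C) (C_cone : cone C)
    (KC : K `<=` C) (K_nonempty : K !=set0) (K_closed : closed K)
    (K_unbounded : ~ bounded_set K)
    (K_convex : convex_set (K : set (convex_lmodType 'rV[R]_n)))
    (U_open : open U) (KU : K `<=` U)
    (f_continuous : {within C, continuous f})
    (alpha_gt0 : 0 < alpha)
    (f_finf : asymptotically_homogeneous C K alpha f finf)
    (f_differentiable : forall x, U x -> differentiable f x)
    (f_pseudoconvex : pseudoconvex U f)
    (kernel_nontrivial : ~ bounded_set (asymptotic_kernel K finf)) :
  (forall v, (asymptotic_kernel K finf `\ 0) v ->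
     exists2 x, K x & 0 < dotv (gradient f x) v)
  <->
  (Sol K f !=set0 /\ bounded_set (Sol K f)).
Proof.
have kernel0 : asymptotic_kernel K finf !=set0.
  apply/set0P/negP => /eqP k0; apply: kernel_nontrivial; rewrite k0.
  by exists 0; split => // r _ x [].
have fK : {within K, continuous f} by exact: continuous_subspaceW f_continuous.
split=> [Ha|[[x [Kx xmin]] [M [Mreal HM]]] v [[Kv _] v0]].
  apply: contrapT => notb.
  (* Without such a point for some [k], the previous lemma with radius [k] would give (b). *)
  have /choice[u Hu] k : exists x, [/\ K x, k%:R <= `|x| &
      forall y, K y -> `|y| <= k%:R -> f x <= f y].
    apply: contrapT => noext; apply: notb.
    apply: (@Sol_nonempty_bounded _ _ _ _ k%:R) => // x Kx kx.
    apply: contrapT => noy; apply: noext; exists x; split => // y Ky yk.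
    by rewrite leNgt; apply/negP => fyx; apply: noy; exists y.
  have Ku k : K (u k) by have [] := Hu k.
  have uk k : k%:R <= `|u k| by have [] := Hu k.
  have fu x : K x -> \forall k \near \oo, f (u k) <= f x.
    move=> Kx; near=> k; have [_ _] := Hu k; apply => //.
    by near: k; exact: nbhs_infty_ger.
  have [v kv Hv] := kernel_descent_direction C_closed C_cone KC
    K_nonempty K_convex KU alpha_gt0 f_finf f_differentiable f_pseudoconvex
    kernel0 Ku uk fu.
  by have [x /Hv + /lt_geF] := Ha _ kv => ->.
apply: contrapT => nox.
have ray (s : R) : 0 <= s -> Sol K f (x + s *: v).
  move=> s0.
  have Kxs : K (x + s *: v) by exact: recession_direction.
  split=> // z /xmin; apply: le_trans; apply: f_pseudoconvex; [exact: KU..|].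
  rewrite opprD addNKr -scaleNr dotvZr mulr_le0 ?oppr_le0 //.
  by rewrite leNgt; apply/negP => vx; apply: nox; exists (x + s *: v).
have nv0 : 0 < `|v| by rewrite normr_gt0; apply/eqP.
(* At parameter [(L + 1) / |v|] the ray point has norm at least [L + 1 - |x| = |M| + 2], beyond the
   bound [|M| + 1] on the solution set. *)
pose L := `|M| + 1 + `|x|.
have L0 : 0 <= L by rewrite !addr_ge0.
have := HM (`|M| + 1) _ _ (ray ((L + 1) / `|v|) _).
have ML : M < `|M| + 1 by rewrite ltr_pwDr // ler_norm.
move=> /(_ ML); rewrite divr_ge0 ?addr_ge0 // => /(_ isT) /=.
apply/negP; rewrite -ltNge.
have := lerB_normD ((L + 1) / `|v| *: v) x.
rewrite normrZ ger0_norm ?divr_ge0 ?addr_ge0 // divfK ?gt_eqF // addrC.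
rewrite [_ + x]addrC /L; lra.
Unshelve. all: by end_near. Qed.
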